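(* Let $\mathcal{I}^2$ be the set $[0,1]\times[0,1]$ with the lexicographic order and the corresponding order topology. Then the topological groups $H_+(\mathcal{I}^2)$ and $H(\mathcal{I}^2)$ are $a$-minimal.
   Context: For a compact linearly ordered topological space $X$, $H(X)$ is the group of all homeomorphisms $X\to X$ with the compact-open topology, and $H_+(X)$ is the subgroup of order-preserving homeomorphisms with the subspace topology. A Hausdorff topological group is $a$-minimal if its topology is the smallest Hausdorff group topology on the underlying group (i.e. it is contained in every Hausdorff group topology on that group). The space $\mathcal{I}^2$ is compact. *)

(* Defs.v *)
From HB Require Import structures.
From mathcomp Require Import all_boot all_order all_algebra.
From mathcomp Require Import all_classical all_reals all_analysis.

Set Implicit Arguments.
Unset Strict Implicit.
Unset Printing Implicit Defensive.

Import Order.TTheory GRing.Theory Num.Theory.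

Local Open Scope classical_set_scope.
Local Open Scope ring_scope.

(* Like the library's [preTopologicalNmodType]: no compatibility is assumed
   between the topology and the group operations. *)
#[short(type="preTopologicalGroupType")]
HB.structure Definition PreTopologicalGroup := {G of Topological G & Group G}.

(* A topology on the carrier of [G] is a [Topological] class record [tau];
   [Topological.Pack tau] is that carrier equipped with [tau]. *)
Definition hausdorff_group_topology (G : groupType) (tau : Topological G) :
    Prop :=
  let T : topologicalType := Topological.Pack tau in
  [/\ continuous (fun xy : T * T => (xy.1 * xy.2)%g : T),
      continuous (fun x : T => (x^-1)%g : T)
    & hausdorff_space T].

Definition a_minimal (G : preTopologicalGroupType) : Prop :=
  hausdorff_group_topology (Topological.class G) /\
  forall sigma : Topological G, hausdorff_group_topology sigma ->
    forall U : set G, @open G U -> @open (Topological.Pack sigma) U.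

Section homeomorphism_group.
Context {X : topologicalType}.

Definition is_homeomorphism (f : X -> X) : Prop :=
  exists g : X -> X,
    [/\ cancel f g, cancel g f, continuous f & continuous g].

(* As a [set_type] over [{compact-open, X -> X}], this type carries the
   topology induced by the compact-open topology. *)
Definition homeo : Type :=
  set_type [set f : {compact-open, X -> X} | is_homeomorphism f].

HB.instance Definition _ := Topological.on homeo.
HB.instance Definition _ := SubChoice.on homeo.

Definition homeo_fun (h : homeo) : X -> X := val h.

Lemma homeoP (h : homeo) : is_homeomorphism (homeo_fun h).
Proof. exact: set_valP. Qed.

Definition mk_homeo (f : X -> X) (fh : is_homeomorphism f) : homeo :=
  SigSub (mem_set fh : f \in [set f : {compact-open, X -> X} | _]).

Lemma homeo_eqP (h k : homeo) : homeo_fun h =1 homeo_fun k -> h = k.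
Proof. by move=> hk; apply/val_inj/funext. Qed.

Lemma is_homeomorphism_id : is_homeomorphism id.
Proof. by exists id; split=> // x U. Qed.

Lemma is_homeomorphism_comp (f g : X -> X) :
  is_homeomorphism f -> is_homeomorphism g -> is_homeomorphism (f \o g).
Proof.
move=> [f' [ff' f'f cf cf']] [g' [gg' g'g cg cg']]; exists (g' \o f').
split; [exact: can_comp | exact: can_comp | |].
- by move=> x; apply: continuous_comp; [exact: cg | exact: cf].
- by move=> x; apply: continuous_comp; [exact: cf' | exact: cg'].
Qed.

Definition homeo_inv_fun (h : homeo) : X -> X := projT1 (cid (homeoP h)).

Lemma homeoK (h : homeo) : cancel (homeo_fun h) (homeo_inv_fun h).
Proof. by rewrite /homeo_inv_fun; case: cid => g []. Qed.

Lemma homeo_invK (h : homeo) : cancel (homeo_inv_fun h) (homeo_fun h).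
Proof. by rewrite /homeo_inv_fun; case: cid => g []. Qed.

Lemma is_homeomorphism_inv (h : homeo) : is_homeomorphism (homeo_inv_fun h).
Proof.
rewrite /homeo_inv_fun; case: cid => g [hg gh ch cg] /=.
by exists (homeo_fun h).
Qed.

Definition homeo_one : homeo := mk_homeo is_homeomorphism_id.
Definition homeo_mul (h k : homeo) : homeo :=
  mk_homeo (is_homeomorphism_comp (homeoP h) (homeoP k)).
Definition homeo_inv (h : homeo) : homeo := mk_homeo (is_homeomorphism_inv h).

Lemma homeo_mulA : associative homeo_mul.
Proof. by move=> f g h; exact: homeo_eqP. Qed.

Lemma homeo_mul1 : left_id homeo_one homeo_mul.
Proof. by move=> f; exact: homeo_eqP. Qed.

Lemma homeo_mulr1 : right_id homeo_one homeo_mul.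
Proof. by move=> f; exact: homeo_eqP. Qed.

Lemma homeo_mulV : left_inverse homeo_one homeo_inv homeo_mul.
Proof. by move=> f; apply: homeo_eqP => x; exact: homeoK. Qed.

Lemma homeo_mulrV : right_inverse homeo_one homeo_inv homeo_mul.
Proof. by move=> f; apply: homeo_eqP => x; exact: homeo_invK. Qed.

HB.instance Definition _ := isGroup.Build homeo homeo_mulA homeo_mul1
  homeo_mulr1 homeo_mulV homeo_mulrV.

End homeomorphism_group.
Arguments homeo : clear implicits.

Section order_preserving.
Context {d : Order.disp_t} {X : orderTopologicalType d}.

Definition order_preserving : set (homeo X) :=
  [set h | {homo homeo_fun h : x y / (x <= y)%O}].

Definition homeo_plus : Type := set_type order_preserving.

HB.instance Definition _ := Topological.on homeo_plus.
HB.instance Definition _ := SubChoice.on homeo_plus.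

Lemma order_preserving_group_closed : group_closed (mem order_preserving).
Proof.
split; first by apply/mem_set => x y.
move=> h k /set_mem hP /set_mem kP; apply/mem_set => x y xy.
apply: hP; rewrite leNgt; apply/negP => yx.
have := kP _ _ (ltW yx); rewrite /= !homeo_invK => yx'.
have xy' : x = y by apply/le_anti; rewrite xy yx'.
by move: yx; rewrite xy' ltxx.
Qed.

HB.instance Definition _ := SubChoice_isSubGroup.Build
  (homeo X) (mem order_preserving) homeo_plus order_preserving_group_closed.

End order_preserving.
Arguments homeo_plus {d} X.

Section lexicographic_square.
Context (R : realType).

Definition unit_interval : Type := {x : R | 0 <= x <= 1}.

HB.instance Definition _ := SubChoice.on unit_interval.
HB.instance Definition _ :=
  [SubChoice_isSubOrder of unit_interval by <: with ring_display].

Definition lexi_square : Type :=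
  order_topology (unit_interval *l unit_interval)%type.

HB.instance Definition _ := OrderTopological.on lexi_square.

End lexicographic_square.

(* Main.v *)
(* Write X for the square.  If a < b in X, then some h and k in H_+(X) supported
   in ]a, b[ do not commute.  In any Hausdorff group topology the set of those g
   for which g h g^-1 and k do not commute is therefore a neighbourhood of 1, and
   each such g satisfies g(]a, b[) /\ ]a, b[ <> empty.  Every homeomorphism of the
   linear continuum X is monotone, so finitely many of these conditions force g
   to be increasing and to move given points as little as desired; by compactness
   this controls the compact-open neighbourhoods of 1.  The pairs h, k come from
   piecewise linear bumps on a single fibre {p} x [0, 1]. *)
Require Import Defs.
From mathcomp Require Import all_boot all_order all_algebra.
From mathcomp Require Import all_classical all_reals all_analysis.
From mathcomp Require Import lra.

Set Implicit Arguments.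
Unset Strict Implicit.
Unset Printing Implicit Defensive.

Import Order.TTheory GRing.Theory Num.Theory.

Local Open Scope classical_set_scope.

(** * The compact-open topology on the homeomorphism group of a compact Hausdorff space *)

Section homeo_topology.
Context {X : topologicalType}.

Lemma homeo_continuous (h : homeo X) : continuous (homeo_fun h).
Proof. by case: (homeoP h) => g []. Qed.

Lemma homeo_inj (h : homeo X) : injective (homeo_fun h).
Proof. exact: can_inj (homeoK h). Qed.

Lemma initial_cvg (S : choiceType) (T : topologicalType) (f : S -> T)
    (F : set_system S) (s : S) :
  Filter F -> f @ F --> f s -> F --> (s : initial_topology f).
Proof.
move=> FF fF A [_ [[B oB <-] Bs BA]].
apply: filterS BA _; apply: fF; exact: open_nbhs_nbhs.
Qed.

Lemma continuous_initial (Z : topologicalType) (S : choiceType)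
    (T : topologicalType) (f : S -> T) (g : Z -> initial_topology f) :
  continuous (f \o g) -> continuous g.
Proof. by move=> fgC z; apply: initial_cvg; exact: fgC. Qed.

(** The sets of maps sending a compact [K] into an open [O] generate the topology, so only they have
    to be tested. *)
Lemma homeo_cvgP (F : set_system (homeo X)) (h : homeo X) : Filter F ->
  F --> h <-> forall K O, compact K -> open O -> homeo_fun h @` K `<=` O ->
    F [set g | homeo_fun g @` K `<=` O].
Proof.
move=> FF; split=> [Fh K O cK oO hKO|FKO].
  apply: Fh; exists [set g | homeo_fun g @` K `<=` O]; split=> //=.
  by exists [set g : {compact-open, X -> X} | g @` K `<=` O] => //;
    exact: compact_open_open.
apply: initial_cvg; apply/compact_open_cvgP => K O cK oO hKO.
exact: FKO.
Qed.


Lemma homeo_hausdorff_group : hausdorff_space X -> compact [set: X] ->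
  hausdorff_group_topology (Topological.class (homeo X)).
Proof.
move=> hX cX; have closed_cpt (C : set X) : closed C -> compact C.
  by move=> cC; exact: (subclosed_compact cC cX).
have cpt_open K O : compact K -> open O ->
    open [set g : homeo X | homeo_fun g @` K `<=` O].
  move=> cK oO; exists [set g : {compact-open, X -> X} | g @` K `<=` O] => //.
  exact: compact_open_open.
split.
- suff mulC : continuous (fun p : homeo X * homeo X => (p.1 * p.2)%g).
    exact: mulC.
  move=> [h k]; apply/homeo_cvgP => K O cK oO /= hkKO.
  have cV : compact (homeo_fun k @` K).
    by apply: continuous_compact cK; apply/continuous_subspaceT/homeo_continuous.
  have oW : open (homeo_fun h @^-1` O).
    by move/continuousP : (@homeo_continuous h); apply.
  (* Normality interpolates [k(K) <= C <= B] with [closure B] inside the preimage of [O] under [h].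
     Factors near [k] send [K] into [C], and factors near [h] send the compact set [closure B] into
     [O]. *)
  have [||B /set_nbhsP[C [oC kKC CB]] BW] :=
    @compact_normal X hX cX (homeo_fun k @` K) _ (homeo_fun h @^-1` O).
  + exact: compact_closed.
  + apply/set_nbhsP; exists (homeo_fun h @^-1` O); split=> // _ [x Kx <-].
    by apply: hkKO; exists x.
  exists ([set g : homeo X | homeo_fun g @` (closure B) `<=` O],
          [set g : homeo X | homeo_fun g @` K `<=` C]).
    split; apply: open_nbhs_nbhs; split.
    + exact/cpt_open/oO/closed_cpt/closed_closure.
    + by move=> _ [y /BW ? <-].
    + exact: cpt_open.
    + exact: kKC.
  move=> [h' k'] [/= h'B k'K] _ [x Kx <-] /=; apply: h'B.
  exists (homeo_fun k' x) => //; apply: subset_closure; apply: CB.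
  by apply: k'K; exists x.
- suff invC : continuous (fun h : homeo X => h^-1%g) by exact: invC.
  move=> h; have FF : Filter (nbhs h) := nbhs_filter h.
  apply/homeo_cvgP => K O cK oO hKO.
  (* Taking complements turns a condition on the inverse of [g] into one on [g]; in a compact
     Hausdorff space [~] O[is compact and]~[K] is open. *)
  have subVE (g : homeo X) : homeo_fun g^-1%g @` K `<=` O <->
      homeo_fun g @` (~` O) `<=` ~` K.
    split=> gKO _ [x Kx <-].
      by move=> Kgx; apply: Kx; apply: gKO; exists (homeo_fun g x);
        rewrite // [LHS]homeoK.
    apply: contrapT => Ox; case: (gKO (homeo_fun g (homeo_fun g^-1%g x))).
      by exists (homeo_fun g^-1%g x).
    by rewrite [homeo_fun g _]homeo_invK.
  suff : nbhs h [set g : homeo X | homeo_fun g @` (~` O) `<=` ~` K].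
    by apply: filterS => g /subVE.
  apply: open_nbhs_nbhs; split; last exact/subVE.
  apply: cpt_open; first exact/closed_cpt/open_closedC.
  by apply: closed_openC; exact: compact_closed.
rewrite open_hausdorff => h k hk.
have [x hkx] : exists x, homeo_fun h x != homeo_fun k x.
  apply: contrapT => /forallNP hkE; case/eqP: hk; apply: homeo_eqP => x.
  by apply/eqP; apply: contrapT => /negP; exact: hkE.
move: hX; rewrite open_hausdorff => /(_ _ _ hkx)[[A B] /= [hA kB] [oA oB AB]].
(* A singleton is compact, so evaluation at [x] separates [h] from [k]. *)
exists ([set g : homeo X | homeo_fun g @` [set x] `<=` A],
        [set g : homeo X | homeo_fun g @` [set x] `<=` B]) => /=.
  by split; apply/mem_set => _ [_ -> <-]; exact/set_mem.
split; try by apply: cpt_open => //; exact: compact_set1.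
apply/eqP; rewrite -subset0 => g [/= gA gB].
suff : (A `&` B) (homeo_fun g x) by rewrite (eqP AB).
by split; [apply: gA | apply: gB]; exists x.
Qed.

End homeo_topology.

Lemma homeo_plus_hausdorff_group d (X : orderTopologicalType d) :
  hausdorff_group_topology (Topological.class (homeo X)) ->
  hausdorff_group_topology (Topological.class (homeo_plus X)).
Proof.
move=> [mulC invC hX].
have valC : continuous (val : homeo_plus X -> homeo X).
  exact: initial_continuous.
split.
- apply: continuous_initial.
  have : continuous ((fun p : homeo X * homeo X => (p.1 * p.2)%g) \o
      (fun p : homeo_plus X * homeo_plus X => (val p.1, val p.2))).
    move=> p; apply: continuous_comp; last exact: mulC.
    case: p => p q U [[A B] /= [/valC Ap /valC Bq] ABU].
    exists (val @^-1` A, val @^-1` B) => //= -[r s] [/= Ar Bs].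
    by apply: ABU; split.
  exact.
- apply: continuous_initial.
  have : continuous ((fun p : homeo X => (p^-1)%g) \o
      (val : homeo_plus X -> homeo X)).
    by move=> p; apply: continuous_comp; [exact: valC | exact: invC].
  exact.
move=> p q pq; apply: val_inj; apply: hX => A B /valC Ap /valC Bq.
by have [r [Ar Br]] := pq _ _ Ap Bq; exists (val r).
Qed.

(** * Neighbourhoods and continuity in an order topology *)

Section order_topology.
Context {d : Order.disp_t} {X : orderTopologicalType d}.
Implicit Types (x y a b l r : X) (U V : set X).
Local Open Scope order_scope.

Lemma nbhs_ltr x r : x < r -> nbhs x [set y | y < r].
Proof.
move=> xr; suff -> : [set y | y < r] = `]-oo, r[%classic.
  by apply: open_nbhs_nbhs; split; [exact: lray_open|rewrite /= in_itv].
by apply/seteqP; split=> y /=; rewrite in_itv.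
Qed.

Lemma nbhs_ltl x l : l < x -> nbhs x [set y | l < y].
Proof.
move=> xr; suff -> : [set y | l < y] = `]l, +oo[%classic.
  by apply: open_nbhs_nbhs; split; [exact: rray_open|rewrite /= in_itv andbT].
by apply/seteqP; split=> y /=; rewrite in_itv andbT.
Qed.

(** Every neighbourhood of [x] contains an interval around [x] that is the intersection of at most
    two open rays, so the two sides can be treated separately. *)
Lemma order_cvg (F : set_system X) x : Filter F ->
  (forall l, l < x -> F [set y | l < y]) ->
  (forall r, x < r -> F [set y | y < r]) -> F --> x.
Proof.
move=> FF Fl Fr U; rewrite itv_nbhsE => -[[lb rb] /= [oi xi] iU].
have {}Fl : F [set y | lb <= BLeft y].
  move: oi xi {iU}; case: lb => [[] l|[]] /=; rewrite itv_boundlr.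
  - by case: rb => [[] r|[]].
  - by move=> _ /andP[lx _]; apply: filterS (Fl _ lx).
  - by move=> _ _; apply: filterE.
  - by [].
have {}Fr : F [set y | BRight y <= rb].
  move: oi xi {iU}; case: rb => [[] r|[]] /=; rewrite itv_boundlr.
  - by move=> _ /andP[_ xr]; apply: filterS (Fr _ xr).
  - by case: lb {Fl} => [[] l|[]].
  - by move=> _ /andP[].
  - by move=> _ _; apply: filterE.
apply: filterS (filterI Fl Fr) => y [yl yr]; apply: iU.
by rewrite /= itv_boundlr yl.
Qed.

Lemma nbhs_leftP x a U : nbhs x U -> a < x ->
  exists u, [/\ a <= u, u < x & forall t, u < t -> t <= x -> U t].
Proof.
move=> xU ax; apply: contrapT => nU.
(* The left-sided intervals []u, x]] form a filter base converging to [x], so one of them lies in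
   [U]. *)
have FF : Filter (filter_from [set u | a <= u < x]
    (fun u => [set t | u < t <= x])).
  apply: filter_from_filter; first by exists a; rewrite /= lexx.
  move=> u v /andP[au ux] /andP[av vx]; exists (Order.max u v) => /=.
    by rewrite gt_max ux vx le_max au.
  move=> t /=; rewrite gt_max -andbA => /and3P[ut vt tx]; split; exact/andP.
have : filter_from [set u | a <= u < x]
    (fun u => [set t | u < t <= x]) --> x.
  apply: order_cvg => [l lx|r xr].
    exists (Order.max a l) => /=; first by rewrite le_max lexx gt_max ax lx.
    by move=> t /=; rewrite gt_max => /andP[/andP[]].
  exists a; first by rewrite /= lexx.
  by move=> t /= /andP[_ tx]; exact: le_lt_trans xr.
move=> /(_ _ xU) [u /andP[au ux] uU]; apply: nU; exists u; split=> // t ut tx.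
by apply: uU; rewrite /= ut.
Qed.

Lemma nbhs_rightP x b U : nbhs x U -> x < b ->
  exists v, [/\ v <= b, x < v & forall t, x <= t -> t < v -> U t].
Proof.
move=> xU xb; apply: contrapT => nU.
have FF : Filter (filter_from [set v | x < v <= b]
    (fun v => [set t | x <= t < v])).
  apply: filter_from_filter; first by exists b; rewrite /= lexx andbT.
  move=> u v /andP[xu ub] /andP[xv vb]; exists (Order.min u v) => /=.
    by rewrite lt_min xu xv ge_min ub.
  move=> t /=; rewrite lt_min => /and3P[xt tu tv]; split; exact/andP.
have : filter_from [set v | x < v <= b]
    (fun v => [set t | x <= t < v]) --> x.
  apply: order_cvg => [l lx|r xr].
    exists b; first by rewrite /= lexx andbT.
    by move=> t /= /andP[tx _]; exact: lt_le_trans tx.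
  exists (Order.min b r) => /=; first by rewrite ge_min lexx lt_min xb xr.
  by move=> t /=; rewrite lt_min => /and3P[].
move=> /(_ _ xU) [v /andP[xv vb] vU]; apply: nU; exists v; split=> // t xt tv.
by apply: vU; rewrite /= xt.
Qed.

(** Open rays pull back to open rays: [l < f y] amounts to [g l < y], and dually. *)
Lemma order_iso_continuous (f g : X -> X) : cancel f g -> cancel g f ->
  {homo f : x y / x < y} -> continuous f.
Proof.
move=> fK gK flt x.
have fltE y z : (f y < f z) = (y < z).
  by apply/idP/idP=> [|/flt //]; case: (ltgtP y z) => // [/flt/lt_gtF-> //|->];
    rewrite ltxx.
apply: order_cvg => [l lx|r xr]; rewrite /nbhs /=.
  have : g l < x by rewrite -fltE gK.
  by move/nbhs_ltl; apply: filterS => y /=; rewrite -fltE gK.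
have : x < g r by rewrite -fltE gK.
by move/nbhs_ltr; apply: filterS => y /=; rewrite -fltE gK.
Qed.

(** * Linear continua: compactness, intermediate values, monotonicity of injections *)

Section continuum.
(** Suprema of the empty and of the full set are included, which provides a least and a greatest
    point. *)
Hypothesis sup_ex : forall A : set X, supremums A !=set0.
Hypothesis dense : forall x y, x < y -> exists2 z, x < z & z < y.

(** An ultrafilter [F] converges to the supremum of those [x] whose upper ray [[x, +oo[] belongs to
    [F]. *)
Lemma complete_compact : compact [set: X].
Proof.
rewrite compact_ultra => F FU _.
have [s [sub sleast]] := sup_ex [set x | F [set y | x <= y]].
exists s; split=> //; apply: order_cvg => [l ls|r sr].
  have [x [Fx lx]] : exists x, F [set y | x <= y] /\ l < x.
    apply: contrapT => /forallNP lF; move: ls; rewrite ltNge => /negP; apply.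
    apply: sleast => x Fx; rewrite leNgt; apply/negP => lx.
    by apply: (lF x).
  by apply: filterS Fx => y /=; exact: lt_le_trans.
have [Fr|] := in_ultra_setVsetC [set y | r <= y] FU.
  by have := sub _ Fr; rewrite leNgt sr.
by apply: filterS => y /= /negP; rewrite -ltNge.
Qed.

(** The supremum [s] of the points of [U] below [b] is in neither set: in [U], points of [U] would
    exist beyond [s]; in [V], a whole left neighbourhood of [s] would miss [U] and a smaller upper
    bound would exist. *)
Lemma interval_connected U V a b : open U -> open V -> a < b -> U a -> V b ->
  U `&` V `<=` set0 -> exists x, [/\ a < x, x < b, ~ U x & ~ V x].
Proof.
move=> oU oV ab Ua Vb UV0.
have [s [sub sleast]] := sup_ex [set x | x < b /\ U x].
have as_ : a <= s by exact: sub.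
have sb : s <= b by apply: sleast => x [/ltW].
have nUs : ~ U s.
  move=> Us; have {}sb : s < b.
    by rewrite lt_neqAle sb andbT; apply/eqP => sb';
      apply: (UV0 s); split=> //; rewrite sb'.
  have [v [vb sv vU]] := nbhs_rightP (open_nbhs_nbhs (conj oU Us)) sb.
  have [t st tv] := dense sv.
  suff : t <= s by rewrite leNgt st.
  by apply: sub; split; [exact: lt_le_trans vb | exact: vU (ltW st) tv].
have nVs : ~ V s.
  move=> Vs; have {}as_ : a < s.
    by rewrite lt_neqAle as_ andbT; apply/eqP => as';
      apply: (UV0 a); split=> //; rewrite as'.
  have [u [au us uV]] := nbhs_leftP (open_nbhs_nbhs (conj oV Vs)) as_.
  move: us; rewrite ltNge => /negP; apply; apply: sleast => x [xb Ux].
  rewrite leNgt; apply/negP => ux; apply: (UV0 x); split=> //.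
  by apply: uV ux _; exact: sub.
exists s; split=> //; rewrite lt_neqAle ?as_ ?sb andbT; apply/eqP.
  by move=> as'; apply: nUs; rewrite -as'.
by move=> sb'; apply: nVs; rewrite sb'.
Qed.

(** If [c] were omitted between [a] and [b], the open sets [f x < c] and [c < f x] would disconnect
    the interval. *)
Lemma intermediate_value (f : X -> X) a b c : continuous f -> a < b ->
  (f a < c /\ c < f b) \/ (f b < c /\ c < f a) ->
  exists x, [/\ a < x, x < b & f x = c].
Proof.
move=> /continuousP fC ab fabc.
have oL : open [set x | f x < c].
  by apply: (fC [set y | y < c]); rewrite openE => y; exact: nbhs_ltr.
have oR : open [set x | c < f x].
  by apply: (fC [set y | c < y]); rewrite openE => y; exact: nbhs_ltl.
suff [x [ax xb xL xR]] : exists x, [/\ a < x, x < b, ~ f x < c & ~ c < f x].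
  exists x; split=> //; apply/le_anti; rewrite !leNgt.
  by apply/andP; split; exact/negP.
case: fabc => -[fac fbc].
  by apply: (interval_connected oL oR ab) => // x [/lt_trans/[apply]]; rewrite ltxx.
have RL0 : [set x | c < f x] `&` [set x | f x < c] `<=` set0.
  by move=> x [/lt_trans/[apply]]; rewrite ltxx.
by have [x [ax xb xR xL]] := interval_connected oR oL ab fbc fac RL0; exists x.
Qed.

(** The larger of the two end values would be taken a second time on the other side of the peak. *)
Lemma injective_no_peak (f : X -> X) a b c : continuous f -> injective f ->
  a < b -> b < c -> f a < f b -> f c < f b -> False.
Proof.
move=> fC fI ab bc fab fcb; case: (ltgtP (f a) (f c)) => [fac|fca|/fI ac].
- have [x [ax xb /fI xc]] := intermediate_value fC ab (or_introl (conj fac fcb)).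
  by move: xb; rewrite xc => /(lt_trans bc); rewrite ltxx.
- have [x [bx xc /fI xa]] := intermediate_value fC bc (or_intror (conj fca fab)).
  by move: bx; rewrite xa => /(lt_trans ab); rewrite ltxx.
- by move: (lt_trans ab bc); rewrite ac ltxx.
Qed.

Lemma injective_no_valley (f : X -> X) a b c : continuous f -> injective f ->
  a < b -> b < c -> f b < f a -> f b < f c -> False.
Proof.
move=> fC fI ab bc fab fcb; case: (ltgtP (f a) (f c)) => [fac|fca|/fI ac].
- have [x [bx xc /fI xa]] := intermediate_value fC bc (or_introl (conj fab fac)).
  by move: bx; rewrite xa => /(lt_trans ab); rewrite ltxx.
- have [x [ax xb /fI xc]] := intermediate_value fC ab (or_intror (conj fcb fca)).
  by move: xb; rewrite xc => /(lt_trans bc); rewrite ltxx.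
- by move: (lt_trans ab bc); rewrite ac ltxx.
Qed.

Lemma injective_monotone (f : X -> X) : continuous f -> injective f ->
  {homo f : x y / x < y} \/ {homo f : x y /~ x < y}.
Proof.
move=> fC fI.
(* The order of [f lo] and [f hi] decides the direction of [f]; a pair [x < y] violating it yields a
   peak or a valley together with [lo] or [hi]. *)
have [lo [_ lo_le]] := sup_ex set0; have [hi [hi_ge _]] := sup_ex setT.
have {}lo_le x : lo <= x by exact: lo_le.
have {}hi_ge x : x <= hi by exact: hi_ge.
have peak := injective_no_peak fC fI; have valley := injective_no_valley fC fI.
case: (ltgtP (f lo) (f hi)) => [lohi|hilo|/fI lohi].
- left=> x y xy; case: (ltgtP (f x) (f y)) => // [fyx|/fI xy']; last first.
    by move: xy; rewrite xy' ltxx.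
  exfalso; have fylo : f y < f lo.
    case: (eqVneq lo x) => [->//|lox].
    have {}lox : lo < x by rewrite lt_neqAle lox lo_le.
    apply: (lt_trans fyx); case: (ltgtP (f x) (f lo)) => // [lofx|/fI xlo].
      by case: (peak _ _ _ lox xy lofx fyx).
    by move: lox; rewrite xlo ltxx.
  have yhi : y < hi.
    rewrite lt_neqAle hi_ge andbT; apply/eqP => yhi.
    by move: fylo; rewrite yhi => /(lt_trans lohi); rewrite ltxx.
  apply: (valley _ _ _ (le_lt_trans (lo_le x) xy) yhi) => //.
  exact: lt_trans lohi.
- right=> y x xy; case: (ltgtP (f y) (f x)) => // [fyx|/fI xy']; last first.
    by move: xy; rewrite xy' ltxx.
  exfalso; have fylo : f lo < f y.
    case: (eqVneq lo x) => [->//|lox].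
    have {}lox : lo < x by rewrite lt_neqAle lox lo_le.
    apply: lt_trans (fyx); case: (ltgtP (f x) (f lo)) => // [lofx|/fI xlo].
      by case: (valley _ _ _ lox xy lofx fyx).
    by move: lox; rewrite xlo ltxx.
  have yhi : y < hi.
    rewrite lt_neqAle hi_ge andbT; apply/eqP => yhi.
    by move: fylo; rewrite yhi => /lt_trans/(_ hilo); rewrite ltxx.
  apply: (peak _ _ _ (le_lt_trans (lo_le x) xy) yhi) => //.
  exact: lt_trans fylo.
left=> x y xy; have := lt_le_trans (le_lt_trans (lo_le x) xy) (hi_ge y).
by rewrite lohi ltxx.
Qed.

End continuum.
End order_topology.

(** * Minimality of the compact-open topology on a linear continuum with bumps *)

Lemma homeo_commute_disjoint (X : topologicalType) (h k : homeo X) :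
  (forall x, homeo_fun h x = x \/ homeo_fun k x = x) -> (h * k = k * h)%g.
Proof.
move=> hk; apply: homeo_eqP => x.
suff: homeo_fun h (homeo_fun k x) = homeo_fun k (homeo_fun h x) by [].
(* By injectivity a map that moves [x] also moves the image of [x], so the other map fixes both
   points. *)
have [hx|nhx] := pselect (homeo_fun h x = x).
  rewrite hx; have [->//|nkx] := pselect (homeo_fun k x = x).
  by case: (hk (homeo_fun k x)) => // /(@homeo_inj _ k)/nkx.
case: (hk x) => // ->.
by case: (hk (homeo_fun h x)) => // /(@homeo_inj _ h)/nhx.
Qed.

Section minimality.
Context {d : Order.disp_t} {X : orderTopologicalType d}.
Local Open Scope order_scope.
Implicit Types a b x y : X.

Hypothesis sup_ex : forall A : set X, supremums A !=set0.
Hypothesis dense : forall x y, x < y -> exists2 z, x < z & z < y.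

Definition supported (h : homeo X) a b :=
  forall x, ~~ (a < x < b) -> homeo_fun h x = x.

Hypothesis bump : forall a b, a < b -> exists (h : homeo X) (p : X),
  [/\ order_preserving h, supported h a b & p < homeo_fun h p].

Lemma noncommuting_supported a b : a < b -> exists h k : homeo X,
  [/\ order_preserving h, order_preserving k, supported h a b, supported k a b
    & (h * k)%g <> (k * h)%g].
Proof.
move=> ab; have [h [p [hP hab php]]] := bump ab.
(* The second bump lives strictly between [p] and its image under [h]; both ends lie in []a, b[]
   because [h] moves them. *)
have [k [q [kP kph qkq]]] := bump php.
have inab x : homeo_fun h x <> x -> a < x < b.
  by move=> hx; apply: contrapT => /negP/hab.
have /andP[ap _] : a < p < b.
  by apply: inab => hp; move: php; rewrite hp ltxx.
have /andP[_ hpb] : a < homeo_fun h p < b.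
  by apply: inab => /(@homeo_inj _ h) hp; move: php; rewrite hp ltxx.
exists h, k; split=> //.
  move=> x nx; apply: kph; apply: contra nx => /andP[px xhp].
  by rewrite (lt_trans ap px) (lt_trans xhp hpb).
(* [h] moves the support of [k] off itself, so commuting would force [k q = q]. *)
move=> hk; have /andP[pq qhp] : p < q < homeo_fun h p.
  by apply: contrapT => /negP/kph kq; move: qkq; rewrite kq ltxx.
have khq : homeo_fun k (homeo_fun h q) = homeo_fun h q.
  by apply: kph; rewrite negb_and -!leNgt (hP _ _ (ltW pq)) orbT.
have : homeo_fun (h * k)%g q = homeo_fun (k * h)%g q by rewrite hk.
rewrite [RHS]khq => /(@homeo_inj _ h) kq.
by move: qkq; rewrite kq ltxx.
Qed.

Section group_topology.
(** An abstract group embedded in [H(X)] with image containing [H_+(X)] covers both groups at once: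
    [phi] will be the identity or the inclusion. *)
Context {G : groupType} (phi : G -> homeo X) (sigma : Topological G).
Hypothesis phiM : {morph phi : g h / (g * h)%g}.
Hypothesis phi_inj : injective phi.
Hypothesis phi_plus : forall h, order_preserving h -> exists g, phi g = h.
Hypothesis sigmaG : hausdorff_group_topology sigma.

Let T : topologicalType := Topological.Pack sigma.
#[local] Instance nbhsT_filter (t : T) : Filter (nbhs t) := nbhs_filter t.

Let act (g : G) : X -> X := homeo_fun (phi g).

Let act1 x : act 1%g x = x.
Proof.
suff -> : act 1%g = homeo_fun (1%g : homeo X) by [].
congr homeo_fun; apply: (@mulgI _ (phi 1%g)).
by rewrite -phiM !mulg1.
Qed.

Let actM g h x : act (g * h)%g x = act g (act h x).
Proof. by rewrite /act phiM. Qed.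

Let actVK g : cancel (act g^-1%g) (act g).
Proof. by move=> x; rewrite -actM mulgV act1. Qed.

Let mulC (f g : T -> T) : continuous f -> continuous g ->
  continuous (fun t : T => (f t * g t)%g : T).
Proof.
move=> fC gC x; have [mC _ _] := sigmaG.
move=> U /(mC (f x, g x))[[A B] /= [fA gB] ABU].
suff : nbhs x ((fun t : T => (f t * g t)%g : T) @^-1` U) by [].
have nAB : nbhs x (f @^-1` A `&` g @^-1` B).
  by apply: (@filterI _ _ (nbhs_filter x)); [exact: fC | exact: gC].
apply: filterS nAB => t [At Bt].
exact: (ABU (f t, g t)).
Qed.

Let cstC (g : T) : continuous (fun _ : T => g).
Proof. by move=> x; exact: cvg_cst. Qed.

Lemma near_meets a b : a < b -> \forall g \near (1%g : T),
  exists y, a < y < b /\ a < act g y < b.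
Proof.
move=> ab; have [h [k [/phi_plus[g gh] /phi_plus[g' gk] hab kab hk]]] :=
  noncommuting_supported ab.
(* The conjugate [c t] depends continuously on [t] and equals [g] at [1], where it does not commute
   with [g']. *)
pose c (t : T) : T := (t * (g : T) * t^-1)%g.
have cC : continuous c.
  have [_ iC _] := sigmaG.
  apply: mulC; last exact: iC.
  by apply: mulC; [move=> x; exact: cvg_id|exact: cstC].
have gg' : (c 1 * g')%g <> (g' * c 1)%g.
  move=> /(congr1 phi); rewrite /c invg1 mulg1 mul1g !phiM gh gk.
  exact: hk.
(* Disjoint open sets around the two products keep them distinct for all [t] near [1]. *)
have [_ _] := sigmaG; rewrite open_hausdorff.
move=> /(_ (c 1 * g')%g (g' * c 1)%g)[|[A B] /=]; first exact/eqP.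
move=> [/set_mem cA /set_mem cB] [oA oB /eqP AB].
have nA : nbhs (1%g : T) [set t | A (c t * g')%g].
  by apply: (mulC cC (@cstC g')); exact: open_nbhs_nbhs.
have nB : nbhs (1%g : T) [set t | B (g' * c t)%g].
  by apply: (mulC (@cstC g') cC); exact: open_nbhs_nbhs.
apply: filterS2 nA nB => t tA tB; apply: contrapT => nt.
suff E : (c t * g')%g = (g' * c t)%g.
  by move: AB; rewrite -subset0 => /(_ (c t * g')%g); apply; split; rewrite // E.
apply: phi_inj; rewrite !phiM; apply: homeo_commute_disjoint => z; rewrite gk.
case: (boolP (a < z < b)) => [zab|/kab]; [left|by right].
(* If [t] moves []a, b[] off itself, then it pulls [z] back outside []a, b[], where [g] is the
   identity; hence [c t] fixes [z]. *)
have tz : act g (act t^-1%g z) = act t^-1%g z.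
  rewrite /act gh; apply: hab; apply/negP => yab; apply: nt.
  by exists (act t^-1%g z); rewrite actVK.
have : act (t * g * t^-1)%g z = z by rewrite !actM tz actVK.
by rewrite /act !phiM.
Qed.

Lemma near_increasing :
  \forall g \near (1%g : T), {homo act g : x y / x < y}.
Proof.
have [[a [c ac]]|nlt] := pselect (exists a c, a < c); last first.
  by apply: nearW => g x y xy; case: nlt; exists x, y.
(* A [g] meeting both adjacent intervals keeps some [y < b] below [b] and some [z > b] above [b], so
   it cannot be decreasing. *)
have [b ab bc] := dense ac.
apply: filterS2 (near_meets ab) (near_meets bc) => g.
move=> [y [/andP[_ yb] /andP[_ gyb]]] [z [/andP[bz _] /andP[bgz _]]].
case: (injective_monotone sup_ex dense (@homeo_continuous _ (phi g))
  (@homeo_inj _ (phi g))) => // gdec.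
have := gdec _ _ (lt_trans yb bz).
by move=> /lt_trans/(_ (lt_trans gyb bgz)); rewrite ltxx.
Qed.

(** Some [y] of []l, w[] stays above [l], and an increasing [g] puts [w] above the image of [y]. *)
Lemma near_gt l w : l < w -> \forall g \near (1%g : T), l < act g w.
Proof.
move=> lw; apply: filterS2 (near_meets lw) near_increasing => g.
move=> [y [/andP[_ yw] /andP[lgy _]]] /(_ _ _ yw).
exact: lt_trans.
Qed.

Lemma near_lt w r : w < r -> \forall g \near (1%g : T), act g w < r.
Proof.
move=> wr; apply: filterS2 (near_meets wr) near_increasing => g.
move=> [y [/andP[wy _] /andP[_ gyr]]] /(_ _ _ wy) /lt_trans; exact.
Qed.

Lemma act_cvg1 x : act y.2 y.1 @[y --> (x, 1%g : T)] --> x.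
Proof.
apply: order_cvg => [l lx|r xr].
  (* The intermediate point [w] makes the bound uniform: for [y > w] and increasing [g],
     [l < act g w < act g y]. *)
  have [w lw wx] := dense lx.
  exists ([set y | w < y], [set g | l < act g w /\ {homo act g : x y / x < y}]).
    split; first exact: nbhs_ltl.
    by apply: filterI; [exact: near_gt | exact: near_increasing].
  by move=> [y g] /= [wy [lgw /(_ _ _ wy)]]; exact: lt_trans.
have [w xw wr] := dense xr.
exists ([set y | y < w], [set g | act g w < r /\ {homo act g : x y / x < y}]).
  split; first exact: nbhs_ltr.
  by apply: filterI; [exact: near_lt | exact: near_increasing].
by move=> [y g] /= [yw [gwr /(_ _ _ yw) /lt_trans]]; exact.
Qed.

Lemma compact_open_coarser : continuous (phi : T -> homeo X).
Proof.
move=> g; apply/homeo_cvgP => K O cK oO gKO.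
have cgK : compact (act g @` K).
  by apply: continuous_compact cK; apply/continuous_subspaceT/homeo_continuous.
(* Compactness of the image of [K] under [g] turns the joint continuity at each [(x, 1)] into one
   neighbourhood of [1] valid for all its points. *)
have n1 : \forall h \near (1%g : T), act g @` K `<=` [set x | O (act h x)].
  move/compact_near_coveringP : cgK; apply => x gKx.
  apply: act_cvg1; apply: open_nbhs_nbhs; split=> //; exact: gKO.
(* Right translation by the inverse of [g] transports this neighbourhood of [1] to one of [g]. *)
have divC : continuous (fun h : T => (h * g^-1)%g : T).
  by apply: mulC; [move=> h; exact: cvg_id|exact: cstC].
have n2 : nbhs (g : T)
    [set h | act g @` K `<=` [set x | O (act (h * g^-1)%g x)]].
  by have := divC g; rewrite /continuous_at mulgV => dg; exact: (dg _ n1).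
apply: filterS n2 => h /= hO _ [x Kx <-].
have -> : homeo_fun (phi h) x = act (h * g^-1)%g (act g x).
  by rewrite -actM mulgVK.
by apply: hO; exists x.
Qed.

End group_topology.
End minimality.

Section continuum_minimality.
Context {d : Order.disp_t} {X : orderTopologicalType d}.
Local Open Scope order_scope.
Hypothesis sup_ex : forall A : set X, supremums A !=set0.
Hypothesis dense : forall x y : X, x < y -> exists2 z, x < z & z < y.
Hypothesis bump : forall a b : X, a < b -> exists (h : homeo X) (p : X),
  [/\ order_preserving h, supported h a b & p < homeo_fun h p].

Lemma homeo_a_minimal : a_minimal (homeo X).
Proof.
split.
  exact/homeo_hausdorff_group/complete_compact/sup_ex/order_hausdorff.
move=> sigma sigmaG U oU.
(* Continuity of the identity out of [sigma] is exactly the inclusion of the compact-open topology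
   in [sigma]. *)
have /continuousP : continuous (id : Topological.Pack sigma -> homeo X).
  by apply: (compact_open_coarser sup_ex dense bump) => // h _; exists h.
exact.
Qed.

Lemma homeo_plus_a_minimal : a_minimal (homeo_plus X).
Proof.
split.
  apply: homeo_plus_hausdorff_group.
  exact/homeo_hausdorff_group/complete_compact/sup_ex/order_hausdorff.
move=> sigma sigmaG U [V oV <-].
have /continuousP : continuous (val : Topological.Pack sigma -> homeo X).
  apply: (compact_open_coarser sup_ex dense bump (phi := val)) => //.
  by move=> h hP; exists (SigSub (mem_set hP)).
exact.
Qed.
End continuum_minimality.

Local Open Scope ring_scope.

(** * Suprema, density and bumps in the unit interval *)

Section unit_interval.
Context {R : realType}.
Let I := unit_interval R.

Definition mk_unit (x : R) (x01 : 0 <= x <= 1) : I := exist _ x x01.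

Lemma unit_interval_sup (A : set I) : supremums A !=set0.
Proof.
(* The empty set has supremum [0], the least point; otherwise the real supremum stays in the
   interval. *)
have [->|/set0P A0] := eqVneq A set0.
  have zero01 : 0 <= (0 : R) <= 1 by rewrite lexx ler01.
  exists (mk_unit zero01); split=> // x _.
  by have /andP[x0 _] := valP x.
have A0' : (val @` A) !=set0 by case: A0 => a Aa; exists (val a), a.
have A1 : ubound (val @` A) (1 : R).
  by move=> _ [x _ <-]; have /andP[] := valP x.
have sup01 : 0 <= sup (val @` A) <= 1.
  apply/andP; split; last exact: ge_sup.
  have [a Aa] := A0; have /andP[a0 _] := valP a; apply: (le_trans a0).
  by apply: ub_le_sup; [exists 1|exists a].
exists (mk_unit sup01); split=> [x Ax|y Ay].
  by apply: ub_le_sup; [exists 1|exists x].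
by apply: ge_sup => // _ [x Ax <-]; exact: Ay.
Qed.

Lemma unit_interval_dense (c d : I) :
  (c < d)%O -> exists2 z : I, (c < z)%O & (z < d)%O.
Proof.
move=> cd; have {}cd : val c < val d by [].
have /andP[c0 c1] := valP c; have /andP[d0 d1] := valP d.
have z01 : 0 <= (val c + val d) / 2 <= 1 by apply/andP; split; lra.
exists (mk_unit z01).
  by suff : val c < (val c + val d) / 2 by []; lra.
by suff : (val c + val d) / 2 < val d by []; lra.
Qed.

Lemma real_bump (c d : R) : c < d -> exists f g : R -> R,
  [/\ cancel f g, cancel g f, {homo f : x y / x < y},
      forall x, ~~ (c < x < d) -> f x = x
    & exists2 p, c < p < d & p < f p].
Proof.
move=> cd.
(* Slope [2] on the first third of [[c, d]], slope [1/2] on the rest: the break point [(2c + d)/3]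
   goes to [(c + 2d)/3], where the inverse breaks. *)
exists (fun x => if (x <= c) || (d <= x) then x else
  if x <= (2 * c + d) / 3 then 2 * x - c else (x + d) / 2).
exists (fun x => if (x <= c) || (d <= x) then x else
  if x <= (c + 2 * d) / 3 then (x + c) / 2 else 2 * x - d).
split.
- by move=> x /=; repeat case: ifPn; rewrite ?negb_or -?ltNge; lra.
- by move=> x /=; repeat case: ifPn; rewrite ?negb_or -?ltNge; lra.
- by move=> x y /=; repeat case: ifPn; rewrite ?negb_or -?ltNge; lra.
- by move=> x /=; rewrite negb_and -!leNgt => ->.
- exists ((c + d) / 2); first by lra.
  by repeat case: ifPn; rewrite ?negb_or -?ltNge; lra.
Qed.
Lemma unit_interval_bump (c d : I) : (c < d)%O -> exists f g : I -> I,
  [/\ cancel f g, cancel g f, {homo f : x y / (x < y)%O},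
      forall x, ~~ (c < x < d)%O -> f x = x
    & exists2 p, (c < p < d)%O & (p < f p)%O].
Proof.
move=> cd; have [f [g [fK gK flt ffix [p pcd pfp]]]] :=
  @real_bump (val c) (val d) cd.
have /andP[c0 _] := valP c; have /andP[_ d1] := valP d.
have out x : ~~ (0 <= x <= 1) -> f x = x.
  move=> x01; apply: ffix; apply: contra x01 => /andP[cx xd].
  by rewrite (le_trans c0 (ltW cx)) (le_trans (ltW xd) d1).
(* A value outside [[0, 1]] would be a fixed point of [f], hence by injectivity equal to its own
   argument. *)
have f01 (x : I) : 0 <= f (val x) <= 1.
  apply: contrapT => /negP fx01; have /(can_inj fK) fx := out _ fx01.
  by move/negP: fx01; apply; rewrite fx; exact: (valP x).
have g01 (x : I) : 0 <= g (val x) <= 1.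
  apply: contrapT => /negP gx01; have := out _ gx01; rewrite gK => gx.
  by move/negP: gx01; apply; rewrite -gx; exact: (valP x).
have p01 : 0 <= p <= 1.
  case/andP: pcd => cp pd.
  by rewrite (le_trans c0 (ltW cp)) (le_trans (ltW pd) d1).
exists (fun x => mk_unit (f01 x)), (fun x => mk_unit (g01 x)); split.
- by move=> x; apply: val_inj; exact: fK.
- by move=> x; apply: val_inj; exact: gK.
- by move=> x y; exact: flt.
- by move=> x ncd; apply: val_inj; exact: ffix.
- by exists (mk_unit p01).
Qed.
End unit_interval.

(** * The lexicographic square is a linear continuum with bumps *)

Section lexi_square.
Context {R : realType}.
Let I := unit_interval R.
Let X := lexi_square R.
Local Open Scope order_scope.

Lemma lexi_leP (x y : X) :
  reflect (x.1 < y.1 \/ x.1 = y.1 /\ x.2 <= y.2) (x <= y).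
Proof.
suff -> : (x <= y) = (x.1 <= y.1) && ((y.1 <= x.1) ==> (x.2 <= y.2)).
  apply: (iffP andP) => [[]|[xy|[-> xy2]]].
  - by rewrite le_eqVlt => /predU1P[->|xy _]; [rewrite lexx; right|left].
  - by rewrite (ltW xy) leNgt xy.
  - by rewrite lexx.
by [].
Qed.

Lemma lexi_ltP (x y : X) :
  reflect (x.1 < y.1 \/ x.1 = y.1 /\ x.2 < y.2) (x < y).
Proof.
have -> : (x < y) = ~~ (y <= x) by rewrite ltNge.
apply: (iffP negP) => [yx|xy /lexi_leP yx].
  case: (ltgtP x.1 y.1) => [xy|xy|xy]; first by left.
    by case: yx; apply/lexi_leP; left.
  right; split=> //; rewrite ltNge; apply/negP => yx2.
  by apply: yx; apply/lexi_leP; right.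
case: xy yx => [xy|[xy1 xy2]] [yx|[yx1 yx2]].
- by move: (lt_trans xy yx); rewrite ltxx.
- by move: xy; rewrite yx1 ltxx.
- by move: yx; rewrite xy1 ltxx.
- by move: (lt_le_trans xy2 yx2); rewrite ltxx.
Qed.

Lemma lexi_square_sup (A : set X) : supremums A !=set0.
Proof.
have [p [pub pleast]] := unit_interval_sup [set x.1 | x in A].
(* If [A] misses the fibre over [p], then [q] is the supremum of the empty set, so [(p, q)] is the
   bottom of that fibre, as it should be. *)
have [q [qub qleast]] := unit_interval_sup [set y | A (p, y)].
exists ((p, q) : X); split=> [x Ax|z Az]; apply/lexi_leP.
  have := pub x.1 (ex_intro2 _ _ x Ax erefl).
  rewrite le_eqVlt => /predU1P[xp|]; last by left.
  by right; split=> //; apply: qub; rewrite /= -xp; case: x Ax {xp}.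
have := pleast z.1; rewrite le_eqVlt => pz.
have /predU1P[pz1|] : (p == z.1) || (p < z.1).
  apply: pz => _ [x Ax <-]; have /lexi_leP[/ltW//|[->]//] := Az _ Ax.
- right; split=> //; apply: qleast => y /Az /lexi_leP[|[]//] /=.
  by rewrite pz1 ltxx.
- by left.
Qed.

(** Distinct first coordinates leave room for the interior of a whole intermediate fibre; otherwise
    both points share a fibre. Density and bumps thus reduce to the unit interval. *)
Lemma lexi_square_fibre (x y : X) : x < y -> exists p (c d : I),
  c < d /\ forall t, c < t < d -> x < ((p, t) : X) < y.
Proof.
move=> /lexi_ltP[/unit_interval_dense[p xp py]|[xy1 xy2]].
  have zero01 : (0 <= (0 : R) <= 1)%R by rewrite lexx ler01.
  have one01 : (0 <= (1 : R) <= 1)%R by rewrite lexx ler01.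
  exists p, (mk_unit zero01), (mk_unit one01); split; first exact: ltr01.
  by move=> t _; apply/andP; split; apply/lexi_ltP; left.
exists x.1, x.2, y.2; split=> // t /andP[xt ty].
by apply/andP; split; apply/lexi_ltP; right.
Qed.

Lemma lexi_square_dense (x y : X) : x < y -> exists2 z, x < z & z < y.
Proof.
move=> /lexi_square_fibre[p [c [d [/unit_interval_dense[t ct td]]]]].
by move=> /(_ t); rewrite ct td => /(_ isT)/andP[]; exists (p, t).
Qed.

Definition fibrewise (p : I) (f : I -> I) (x : X) : X :=
  if x.1 == p then (p, f x.2) else x.

Lemma fibrewiseK p f g : cancel f g -> cancel (fibrewise p f) (fibrewise p g).
Proof.
move=> fK [x y]; rewrite /fibrewise /=.
case: (eqVneq x p) => [->|/negbTE xp] /=.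
  by rewrite eqxx fK.
by rewrite xp.
Qed.

(** First coordinates are preserved, so only pairs inside the fibre over [p] depend on [f]. *)
Lemma fibrewise_lt p f : {homo f : x y / x < y} ->
  {homo fibrewise p f : x y / x < y}.
Proof.
move=> flt x y /lexi_ltP xy; apply/lexi_ltP; rewrite /fibrewise.
case: (eqVneq x.1 p) xy => [->|xp]; case: (eqVneq y.1 p) => [->|yp] //=.
- by rewrite ltxx => -[//|[_ /flt]]; right.
- by case=> [|[py _]]; [left|rewrite py eqxx in yp].
- by case=> [|[xp' _]]; [left|rewrite xp' eqxx in xp].
Qed.

Lemma lexi_square_bump (a b : X) : a < b -> exists (h : homeo X) (p : X),
  [/\ order_preserving h, supported h a b & p < homeo_fun h p].
Proof.
move=> /lexi_square_fibre[p [c [d [cd cdab]]]].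
have [f [g [fK gK flt ffix [t tcd tft]]]] := unit_interval_bump cd.
have FK := fibrewiseK p fK; have GK := fibrewiseK p gK.
have Flt := fibrewise_lt p flt.
have Glt : {homo fibrewise p g : x y / x < y}.
  move=> x y xy; rewrite ltNge; apply/negP; rewrite le_eqVlt => /predU1P[yx|/Flt].
    by move: xy; rewrite -(GK x) -(GK y) yx ltxx.
  by rewrite !GK => /(lt_trans xy); rewrite ltxx.
(* Continuity in the order topology follows from monotonicity of the map and of its inverse
   alone. *)
have hF : is_homeomorphism (fibrewise p f).
  exists (fibrewise p g); split=> //.
    exact: (order_iso_continuous FK GK).
  exact: (order_iso_continuous GK FK).
exists (mk_homeo hF), (p, t); split.
- by move=> x y; rewrite le_eqVlt => /predU1P[->//|/Flt/ltW].
- move=> [x y] nab; rewrite [LHS]/(fibrewise p f (x, y)) /fibrewise /=.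
  case: (eqVneq x p) => // xp.
  by rewrite ffix ?xp //; apply: contra nab => /cdab; rewrite xp.
- rewrite [X in _ < X]/(fibrewise p f (p, t)) /fibrewise eqxx.
  by apply/lexi_ltP; right.
Qed.

End lexi_square.

Theorem mainTheorem4 (R : realType) :
  a_minimal (homeo_plus (lexi_square R)) /\ a_minimal (homeo (lexi_square R)).
Proof.
split.
  exact: homeo_plus_a_minimal lexi_square_sup lexi_square_dense lexi_square_bump.
exact: homeo_a_minimal lexi_square_sup lexi_square_dense lexi_square_bump.
Qed.
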